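(* Let $\mathcal T$ be an $r$-partite $r$-uniform intersecting hypergraph, and let $S\in\mathcal T$ be an edge such that $S$ intersects every other edge of $\mathcal T$ in exactly one vertex, $\tau(\mathcal T- S)=r-1$, and the only covers of $\mathcal T- S$ of size $r-1$ are sides of $\mathcal T$. Then there exists an intersecting $(r+1)$-Ryser hypergraph $\mathcal H$.
   Context: A hypergraph is a family of subsets (edges) of a vertex set. It is $r$-uniform if every edge has $r$ vertices. It is $r$-partite if its vertex set is partitioned into $r$ sets $V_1,\dots,V_r$, called its sides, so that every edge contains at most one vertex from each side. A cover is a set of vertices meeting every edge; $\tau(\mathcal H)$ is the minimum size of a cover. A matching is a set of pairwise disjoint edges; $\nu(\mathcal H)$ is the maximum size of a matching. A hypergraph is intersecting if $\nu(\mathcal H)=1$. For an edge $S$ of $\mathcal T$, $\mathcal T-S$ denotes the hypergraph on the same vertex set (with the same sides) obtained by deleting the edge $S$ from the edge set. An $r$-Ryser hypergraph is an $r$-partite $r$-uniform hypergraph $\mathcal H$ with $\tau(\mathcal H)=(r-1)\nu(\mathcal H)$; thus an intersecting $(r+1)$-Ryser hypergraph is an $(r+1)$-partite $(r+1)$-uniform hypergraph with $\nu=1$ and $\tau=r$. *)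

(* Defs.v *)
From mathcomp Require Import all_boot.

Set Implicit Arguments.
Unset Strict Implicit.
Unset Printing Implicit Defensive.

(* A hypergraph on the vertex set V is its set of edges, H : {set {set V}}. *)
Section Hypergraph.
Variable V : finType.
Implicit Types (H M : {set {set V}}) (C : {set V}) (r : nat).

Definition uniform r H : Prop := {in H, forall e : {set V}, #|e| = r}.

(* An empty side is not excluded, but it cannot occur in a nonempty r-uniform *)
(* hypergraph whose edges meet each of the r sides at most once.              *)
Definition partite r (side : 'I_r -> {set V}) H : Prop :=
  [/\ forall i j, i != j -> [disjoint side i & side j],
      \bigcup_i side i = [set: V]
    & {in H, forall (e : {set V}) i, #|e :&: side i| <= 1}].

Definition vertex_cover H C : bool := [forall e in H, ~~ [disjoint e & C]].

(* The default #|V| is the size of [set: V], which is a cover as soon as H    *)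
(* has one, i.e., unless set0 \in H; so it never changes the minimum.         *)
Definition tau H : nat := \big[minn/#|V|]_(C | vertex_cover H C) #|C|.

Definition matching H M : bool :=
  (M \subset H) &&
  [forall e in M, forall f in M, (e != f) ==> [disjoint e & f]].

Definition nu H : nat := \max_(M | matching H M) #|M|.

Definition intersecting H : Prop := nu H = 1.

Definition ryser r (side : 'I_r -> {set V}) H : Prop :=
  [/\ partite side H, uniform r H & tau H = r.-1 * nu H].

End Hypergraph.

(* Main.v *)
Require Import Defs.
From mathcomp Require Import all_boot.

(** Let [S = {s_1, ..., s_r}] with [s_i] on side [i], and let [r >= 3].  Add new
    vertices [s'_i] on side [i] and [x_i] on a new side.  Extend every edge [e]
    of [T - S], say with [S :&: e = {s_i}], to [e + x_i], and add the [r] edges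
    [f_i = S - s_i + s'_i + x_i].  The resulting hypergraph is intersecting and
    is covered by [S].  If it had a cover [C] of size at most [r - 1], then
    sending [x_i] and [s'_i] back to [s_i] would turn [C] into a cover of [T - S]
    of size [r - 1], that is, into a side [V_j], without identifying any two
    vertices of [C].  But then [C] misses [f_j] if it contains [s_j], and misses
    [f_k] for all [k != j] if it contains [x_j].  For [r = 2] the edges [f_1] and
    [f_2] are disjoint, and the truncated Fano plane is used instead; [r <= 1]
    is incompatible with the hypotheses. *)

Set Implicit Arguments.
Unset Strict Implicit.
Unset Printing Implicit Defensive.

(** * Covers, matchings and colourings of hypergraphs *)

Section HypergraphTheory.
Variable V : finType.
Implicit Types (H M : {set {set V}}) (C e f : {set V}).

Lemma vertex_coverP H C :
  reflect {in H, forall e, exists2 v, v \in e & v \in C} (vertex_cover H C).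
Proof.
apply: (iffP forall_inP) => hC e /hC; last first.
  by case=> v ve vC; apply/pred0Pn; exists v; rewrite /= ve.
by case/pred0Pn=> v /andP[ve vC]; exists v.
Qed.

Lemma tau_le_card H C : vertex_cover H C -> tau H <= #|C|.
Proof.
rewrite /tau => coverC; have: C \in index_enum {set V} by rewrite mem_index_enum.
elim: (index_enum _) => // D s IHs; rewrite inE big_cons.
case/predU1P=> [<-|/IHs les]; first by rewrite coverC geq_minl.
by case: ifP => // _; apply: leq_trans les; apply: geq_minr.
Qed.

Lemma tau_attained H :
  set0 \notin H -> exists2 C, vertex_cover H C & #|C| = tau H.
Proof.
move=> H0; rewrite /tau; elim/big_ind: _ => [|m n|C]; last by exists C.
  (* The default [#|V|] of the minimum is the size of the full vertex set, a cover because no edge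
     is empty. *)
  exists [set: V]; last by rewrite cardsT.
  apply/vertex_coverP => e eH; have [e0|[v ve]] := set_0Vmem e.
    by rewrite -e0 eH in H0.
  by exists v.
case=> [C coverC <-] [D coverD <-].
by rewrite /minn; case: ifP => _; [exists C | exists D].
Qed.

Lemma intersectingP H :
  intersecting H <->
  H != set0 /\ {in H &, forall e f, e != f -> exists2 v, v \in e & v \in f}.
Proof.
split=> [nu1|[/set0Pn[e0 e0H] meetH]].
  split.
    apply/eqP => H0; move: nu1; rewrite /intersecting /nu big1 // => M.
    by rewrite /matching H0 subset0 => /andP[/eqP-> _]; rewrite cards0.
  move=> e f eH fH ef; suff: ~~ [disjoint e & f].
    by case/pred0Pn=> v /andP[ve vf]; exists v.
  apply/negP => dis_ef; suff: 2 <= nu H by rewrite nu1.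
  have <-: #|[set e; f]| = 2 by rewrite cards2 ef.
  apply: leq_bigmax_cond; rewrite /matching subUset !sub1set eH fH /=.
  apply/forall_inP => a /set2P[]-> ; apply/forall_inP => b /set2P[]->;
    by rewrite ?eqxx // ?dis_ef ?implybT // disjoint_sym dis_ef implybT.
apply/eqP; rewrite eqn_leq; apply/andP; split; last first.
  rewrite -(cards1 e0); apply: leq_bigmax_cond; rewrite /matching sub1set e0H.
  apply/forall_inP => a /set1P->; apply/forall_inP => b /set1P->.
  by rewrite eqxx.
apply/bigmax_leqP => M /andP[/subsetP MH /forall_inP disM].
apply/card_le1_eqP => e f eM fM; apply/eqP; apply/negPn/negP => ef.
have [v ve vf] := meetH _ _ (MH _ fM) (MH _ eM) ef.
have /implyP/(_ ef)/pred0P/(_ v) := forall_inP (disM f fM) e eM.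
by rewrite /= ve vf.
Qed.

(** The sides partition [V], so they are the fibres of a colouring; meeting each side at most once
    becomes injectivity on edges. *)
Lemma partite_colouring r (side : 'I_r -> {set V}) H :
  partite side H ->
  exists col : V -> 'I_r,
    (forall i v, (v \in side i) = (col v == i)) /\
    {in H, forall e, {in e &, injective col}}.
Proof.
case=> dis cov le1.
have /fin_all_exists[col colP]: forall v, exists i, v \in side i.
  move=> v; have: v \in \bigcup_i side i by rewrite cov inE.
  by case/bigcupP=> i _ vi; exists i.
exists col; split=> [i v|e eH u v ue ve uv].
  have [<-|ne] := eqVneq (col v) i; first exact: colP.
  exact: disjointFr (dis _ _ ne) (colP v).
have /card_le1_eqP := le1 e eH (col u); apply.
  by rewrite inE ve uv colP.
by rewrite inE ue colP.
Qed.

(** With [nu H = 1] the Ryser equality reads [tau H = r]: [C] gives the upper bound, and [lower]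
    applied to a minimum cover gives the other. *)
Lemma ryser_of_colouring r (col : V -> 'I_r.+1) H C :
  {in H, forall e, {in e &, injective col}} -> uniform r.+1 H -> H != set0 ->
  {in H &, forall e f, e != f -> exists2 v, v \in e & v \in f} ->
  vertex_cover H C -> #|C| <= r ->
  (forall D, vertex_cover H D -> r <= #|D|) ->
  ryser (fun i => [set v | col v == i]) H /\ intersecting H.
Proof.
move=> colH unifH H0 meetH coverC Cr lower.
have intH : intersecting H by apply/intersectingP.
split=> //; split=> //.
  split=> [i j ij||e eH i].
  - apply/pred0P => v /=; rewrite !inE; apply/negP => /andP[/eqP-> /eqP jE].
    by rewrite jE eqxx in ij.
  - by apply/setP => v; rewrite inE; apply/bigcupP; exists (col v); rewrite ?inE.
  - apply/card_le1_eqP => u v; rewrite !inE => /andP[ue /eqP ui] /andP[ve /eqP vi].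
    by apply: (colH e eH) => //; rewrite ui vi.
rewrite intH muln1 /=; apply/eqP.
rewrite eqn_leq (leq_trans (tau_le_card coverC) Cr) /=.
have /tau_attained[D coverD <-] : set0 \notin H.
  by apply/negP => /unifH; rewrite cards0.
exact: lower.
Qed.

End HypergraphTheory.

Lemma truncated_fano_ryser :
  exists (W : finType) (sideH : 'I_3 -> {set W}) (H : {set {set W}}),
    ryser sideH H /\ intersecting H.
Proof.
(* The three nonzero linear forms on the plane over the field of two elements. Edges are the graphs
   of [val p]. For [p != q] exactly one form vanishes at the difference of [p] and [q], so the two
   edges meet. *)
pose val (p : bool * bool) (i : 'I_3) := nth false [:: p.1; p.2; p.1 (+) p.2] i.
pose E p := [set (i, val p i) | i : 'I_3].
have inE2 p i b : ((i, b) \in E p) = (b == val p i).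
  by apply/imsetP/eqP => [[j _ [-> ->]]|->] //; exists i.
have val_onto i b : exists p, val p i = b.
  exists (b, (i != ord_max) && b).
  by case: i => [[|[|[|i]]]] //= i3; rewrite /val /= addbF.
exists ('I_3 * bool)%type; eexists; exists (E @: setT).
apply: (@ryser_of_colouring _ 2 fst _ [set (ord0, true); (ord0, false)]).
- move=> _ /imsetP[p _ ->] [i b] [j c]; rewrite !inE2 /= => /eqP-> /eqP->.
  by move->.
- by move=> _ /imsetP[p _ ->]; rewrite card_imset ?card_ord // => i j [].
- by apply/set0Pn; exists (E (true, true)); apply: imset_f.
- move=> _ _ /imsetP[p _ ->] /imsetP[q _ ->] _.
  have [i pq] : exists i, val p i = val q i.
    by case: p q => [[] []] [[] []]; do [by exists ord0
      | by exists (@Ordinal 3 1 isT) | by exists (@Ordinal 3 2 isT)].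
  by exists (i, val p i); rewrite inE2 ?pq.
- apply/vertex_coverP => _ /imsetP[p _ ->]; exists (ord0, val p ord0).
    by rewrite inE2.
  by rewrite !inE; case: (val p ord0).
- by rewrite cards2.
(* A single vertex [(i, b)] misses every edge taking the value [~~ b] at [i], and [val_onto]
   supplies one. *)
- move=> D /vertex_coverP coverD; rewrite ltnNge; apply/negP => /card_le1_eqP D1.
  have [//|[i b] _ ibD] := coverD (E (true, true)); first exact: imset_f.
  have [p pi] := val_onto i (~~ b).
  have [//|[j c]] := coverD (E p); first exact: imset_f.
  rewrite inE2 => /eqP cE /(D1 _ _ ibD) [ji cb].
  by move: cE; rewrite ji cb pi; case: (b).
Qed.

(** * The extended hypergraph for [r > 2] *)

Section Extension.
Variables (r : nat) (V : finType) (side : 'I_r -> {set V}).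
Variables (T : {set {set V}}) (S : {set V}) (col : V -> 'I_r).
Implicit Types (e f : {set V}) (s t u v : V).
Hypothesis colP : forall i v, (v \in side i) = (col v == i).
Hypothesis col_inj : {in T, forall e, {in e &, injective col}}.
Hypothesis r_gt2 : 2 < r.
Hypothesis T_uniform : uniform r T.
Hypothesis T_meet : {in T &, forall e f, e != f -> exists2 v, v \in e & v \in f}.
Hypothesis S_edge : S \in T.
Hypothesis S_meets : forall e, e \in T -> e != S -> #|S :&: e| = 1.
Hypothesis tau_TS : tau (T :\ S) = r.-1.
Hypothesis covers_TS : forall C : {set V},
  vertex_cover (T :\ S) C -> #|C| = r.-1 -> exists i, C = side i.

(* [Twin s] and [Apex s] play the roles of [s'_i] and [x_i] for [s = s_i]; for
   [s] outside [S] they are isolated vertices. *)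
Let W : finType := ((V + V) + V)%type.
Local Notation Old v := (inl (inl v) : W).
Local Notation Twin v := (inl (inr v) : W).
Local Notation Apex v := (inr v : W).

Let proj (w : W) : V := match w with inl (inl v) | inl (inr v) | inr v => v end.
Let colW (w : W) : 'I_r.+1 :=
  if w is inl _ then lift ord0 (col (proj w)) else ord0.

(** Taking the apexes over all of [S :&: e] avoids choosing its single point. *)
Let ext (e : {set V}) : {set W} :=
  [set w : W | match w with
    | inl (inl v) => v \in e
    | inl (inr _) => false
    | inr v => v \in S :&: e end].

Let fresh (s : V) : {set W} :=
  [set w : W | match w with
    | inl (inl v) => v \in S :\ s
    | inl (inr v) | inr v => v == s end].

Let H := (ext @: (T :\ S)) :|: (fresh @: S).

Let card_W (A : {set W}) :
  #|A| = #|[set v | Old v \in A]| + #|[set v | Twin v \in A]|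
         + #|[set v | Apex v \in A]|.
Proof. by rewrite -!sum1dep_card -sum1_card !big_sumType. Qed.

Let edgeP A : A \in H ->
  (exists2 e, e \in T :\ S & A = ext e) \/ (exists2 s, s \in S & A = fresh s).
Proof. by case/setUP => /imsetP[a]; [left | right]; exists a. Qed.

Let ext_edge e : e \in T :\ S -> ext e \in H.
Proof. by move=> eT; rewrite inE imset_f. Qed.

Let fresh_edge s : s \in S -> fresh s \in H.
Proof. by move=> sS; rewrite inE orbC imset_f. Qed.

Let S_inj : {in S &, injective col}. Proof. exact: col_inj. Qed.

Let S_point e : e \in T :\ S -> exists s, S :&: e = [set s].
Proof. by case/setD1P=> eS eT; apply/cards1P; rewrite S_meets. Qed.

(** Here [#|S| = r > 2] is used. The vertex [u] is common to [fresh s] and [fresh t]; with [s = t]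
    it is just another vertex of [S]. *)
Let third s t : exists2 u, u \in S & (u != s) && (u != t).
Proof.
have: 0 < #|S :\: [set s; t]|.
  rewrite cardsD subn_gt0 (T_uniform S_edge); apply: leq_ltn_trans r_gt2.
  apply: leq_trans (subset_leq_card (subsetIr _ _)) _.
  by rewrite cards2; case: eqP.
by case/card_gt0P => u; rewrite !inE negb_or => /andP[? ?]; exists u.
Qed.

(** An extended edge has only one apex, and [Twin s] takes the colour freed by removing [s] from
    [S]. *)
Let H_col : {in H, forall A : {set W}, {in A &, injective colW}}.
Proof.
move=> A /edgeP[[e eTS ->]|[s sS ->]] [[u|u]|u] [[v|v]|v];
  rewrite !inE /colW //= => uA vA; try by move/eqP; rewrite ?neq_lift // eq_sym.
- by move/lift_inj => /(col_inj (proj2 (setD1P eTS)) uA vA) ->.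
- have [s sE] := S_point eTS.
  by move: uA vA; rewrite -!in_setI sE => /set1P-> /set1P->.
- by case/andP: uA vA => _ uS /andP[_ vS] /lift_inj /(S_inj uS vS) ->.
- by case/andP: uA => us uS; move/eqP: vA us => -> us /lift_inj /(S_inj uS sS) uE;
    rewrite uE eqxx in us.
- by case/andP: vA => vs vS; move/eqP: uA vs => -> vs /lift_inj /(S_inj sS vS) vE;
    rewrite vE eqxx in vs.
- by rewrite (eqP uA) (eqP vA).
- by rewrite (eqP uA) (eqP vA).
Qed.

Let H_uniform : uniform r.+1 H.
Proof.
move=> A /edgeP[[e eTS ->]|[s sS ->]]; rewrite card_W.
  have [eS eT] := setD1P eTS.
  have -> : [set v | Old v \in ext e] = e by apply/setP => v; rewrite !inE.
  have -> : [set v | Twin v \in ext e] = set0 by apply/setP => v; rewrite !inE.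
  have -> : [set v | Apex v \in ext e] = S :&: e by apply/setP => v; rewrite !inE.
  by rewrite cards0 (T_uniform eT) S_meets // addn0 addn1.
have -> : [set v | Old v \in fresh s] = S :\ s by apply/setP => v; rewrite !inE.
have -> : [set v | Twin v \in fresh s] = [set s] by apply/setP => v; rewrite !inE.
have -> : [set v | Apex v \in fresh s] = [set s] by apply/setP => v; rewrite !inE.
by rewrite cards1 -(T_uniform S_edge) (cardsD1 s S) sS add1n !addn1.
Qed.

Let ext_fresh e s : e \in T :\ S ->
  exists2 w, w \in ext e & w \in fresh s.
Proof.
case/S_point=> t tE; have : t \in S :&: e by rewrite tE set11.
(* If [e] meets [S] in [s] itself, the apex is shared; otherwise the meeting point survives in
   [S :\ s]. *)
case/setIP=> tS te; have [ts|ts] := eqVneq t s.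
  by exists (Apex s); rewrite !inE ?eqxx // -ts tS.
by exists (Old t); rewrite !inE ?ts.
Qed.

Let H_meet : {in H &, forall A B : {set W},
  A != B -> exists2 w, w \in A & w \in B}.
Proof.
move=> A B /edgeP[[e eTS ->]|[s sS ->]] /edgeP[[f fTS ->]|[t tS ->]] AB.
- have ef : e != f by apply: contraNneq AB => ->.
  have [v ve vf] := T_meet (proj2 (setD1P eTS)) (proj2 (setD1P fTS)) ef.
  by exists (Old v); rewrite inE.
- exact: ext_fresh.
- by have [w] := ext_fresh s fTS; exists w.
- by have [u uS /andP[us ut]] := third s t; exists (Old u); rewrite !inE ?us ?ut.
Qed.

Let H_cover : vertex_cover H [set Old v | v in S].
Proof.
apply/vertex_coverP => A /edgeP[[e /S_point[s sE] ->]|[s sS ->]].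
  have /setIP[sS se] : s \in S :&: e by rewrite sE set11.
  by exists (Old s); rewrite ?inE // imset_f.
have [u uS /andP[us _]] := third s s.
by exists (Old u); rewrite ?inE ?us // imset_f.
Qed.

Let H_lower (C : {set W}) : vertex_cover H C -> r <= #|C|.
Proof.
move=> /vertex_coverP coverC; rewrite leqNgt; apply/negP => Cr.
(* Twins are left out because no extended edge contains them. *)
pose D := [set v | (Old v \in C) || (v \in S) && (Apex v \in C)].
have coverD : vertex_cover (T :\ S) D.
  apply/vertex_coverP => e eTS; have [[[v|v]|v]] := coverC _ (ext_edge eTS);
    rewrite !inE //.
    by move=> ve vC; exists v; rewrite ?inE ?vC.
  by case/andP=> vS ve vC; exists v; rewrite ?inE ?vS ?vC ?orbT.
have subD : D \subset proj @: C.
  apply/subsetP => v; rewrite inE => /orP[vC|/andP[_ vC]]; apply/imsetP.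
    by exists (Old v).
  by exists (Apex v).
have CrP : #|C| <= r.-1 by rewrite -ltnS prednK // (leq_trans _ r_gt2).
have leD : r.-1 <= #|D| by rewrite -tau_TS tau_le_card.
have leP := leq_imset_card proj C.
(* The chain [r.-1 <= #|D| <= #|proj @: C| <= #|C| <= r.-1] collapses, so [D] is the whole
   projection and [proj] is injective on [C]. *)
have Dr : #|D| = r.-1.
  apply/eqP; rewrite eqn_leq leD andbT.
  exact: leq_trans (subset_leq_card subD) (leq_trans leP CrP).
have DE : D = proj @: C.
  by apply/eqP; rewrite eqEcard subD Dr (leq_trans leP CrP).
have projI : {in C &, injective proj}.
  by apply/imset_injP; rewrite eqn_leq leP -DE Dr CrP.
have [j Dj] := covers_TS coverD Dr.
have projC w : w \in C -> col (proj w) = j.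
  by move=> wC; apply/eqP; rewrite -colP -Dj DE imset_f.
(* The [r] vertices of [S] have distinct colours, hence use all [r] of them. *)
have [s sS sj] : exists2 s, s \in S & col s = j.
  have: j \in col @: S.
    suff -> : col @: S = setT by [].
    apply/eqP; rewrite eqEcard subsetT cardsT card_ord card_in_imset //.
    by rewrite (T_uniform S_edge) leqnn.
  by case/imsetP=> s sS ->; exists s.
have: s \in D by rewrite Dj colP sj.
rewrite inE sS /= => /orP[sC|sC].
  (* Case [Old s] in [C]: the old vertices of [fresh s] lie off side [j], and its twin and apex
     project to [s], as [Old s] already does. *)
  have [[[u|u]|u]] := coverC _ (fresh_edge sS); rewrite !inE.
  - case/andP=> us uS /projC /= uj; case/eqP: us.
    by apply: S_inj => //; rewrite uj sj.
  - by move/eqP=> -> /(projI _ _ sC)/(_ erefl).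
  - by move/eqP=> -> /(projI _ _ sC)/(_ erefl).
(* Case [Apex s] in [C]: only [Old s] in [fresh t] projects to side [j], and injectivity of [proj]
   keeps it out of [C]. *)
have [t tS /andP[ts _]] := third s s.
have only_s u : u \in S -> col u = j -> u = s.
  by move=> uS uj; apply: S_inj => //; rewrite uj sj.
have [[[u|u]|u]] := coverC _ (fresh_edge tS); rewrite !inE.
- by case/andP=> _ uS uC; have /= /(only_s _ uS) us := projC _ uC;
    move: uC; rewrite us => /(projI _ _ sC)/(_ erefl).
- by move/eqP=> -> /projC /= /(only_s _ tS) tE; rewrite tE eqxx in ts.
- by move/eqP=> -> /projC /= /(only_s _ tS) tE; rewrite tE eqxx in ts.
Qed.

Lemma extension_ryser :
  exists (W : finType) (sideH : 'I_r.+1 -> {set W}) (H : {set {set W}}),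
    ryser sideH H /\ intersecting H.
Proof.
exists W; eexists; exists H.
apply: (ryser_of_colouring H_col H_uniform _ H_meet H_cover _ H_lower).
  have [s sS _] : exists2 s, s \in S & true.
    have /card_gt0P[s sS] : 0 < #|S| by rewrite T_uniform // (leq_trans _ r_gt2).
    by exists s.
  by apply/set0Pn; exists (fresh s); apply: fresh_edge.
by rewrite card_imset ?T_uniform // => u v [].
Qed.

End Extension.

Theorem theorem1p2 (r : nat) (V : finType) (side : 'I_r -> {set V})
    (T : {set {set V}}) (S : {set V})
    (T_partite : partite side T)
    (T_uniform : uniform r T)
    (T_intersecting : intersecting T)
    (S_edge : S \in T)
    (S_meets : forall e : {set V}, e \in T -> e != S -> #|S :&: e| = 1)
    (tau_TS : tau (T :\ S) = r.-1)
    (covers_TS : forall C : {set V},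
       vertex_cover (T :\ S) C -> #|C| = r.-1 -> exists i : 'I_r, C = side i) :
  exists (W : finType) (sideH : 'I_r.+1 -> {set W}) (H : {set {set W}}),
    ryser sideH H /\ intersecting H.
Proof.
have [col [colP col_inj]] := partite_colouring T_partite.
have [_ T_meet] := (intersectingP T).1 T_intersecting.
have [r_gt2|] := ltnP 2 r.
  exact: (extension_ryser colP col_inj _ _ _ S_edge).
rewrite leq_eqVlt => /orP[/eqP r2|r_le1].
  by subst r; exact: truncated_fano_ryser.
(* For [r <= 1], an empty edge could not meet [S] in one vertex, so a minimum cover exists. It is a
   side, which forces [r = 1]; then it is empty, yet as the only side it contains the vertex of
   [S]. *)
have /tau_attained[C coverC] : set0 \notin T :\ S.
  by apply/negP => /setD1P[S0 /S_meets/(_ S0)]; rewrite setI0 cards0.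
rewrite tau_TS => Cr; have [i Ci] := covers_TS C coverC Cr.
have r1 : r = 1.
  by apply/eqP; rewrite eqn_leq -ltnS r_le1 (leq_trans _ (ltn_ord i)).
have /card_gt0P[s _] : 0 < #|S| by rewrite T_uniform // r1.
have: s \in C.
  rewrite Ci colP; apply/eqP; move: (col s) i {Ci}; rewrite r1 => k i.
  by rewrite !ord1.
by move: Cr; rewrite r1 => /eqP; rewrite cards_eq0 => /eqP->; rewrite inE.
Qed.
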